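(* Let $\Lambda\subset\mathbb{R}^d$ be a Delone set and assume that $\Lambda$ is $\varepsilon$-linearly repetitive for some fixed $\varepsilon<r_\Lambda$ (where $\varepsilon>0$). Then there exist an asymptotic density $\mu$ and constants $\alpha>0$ and $0<\delta<1/2$ such that for every box $B\subset\mathbb{R}^d$ we have $$\bigl|\#(\Lambda\cap B)-\mu\cdot\mathrm{vol}(B)\bigr|\le \alpha\cdot\frac{\mathrm{vol}(B)}{\ell(B)^{\delta}},$$ where $\alpha$ and $\delta$ depend on $d$, $\varepsilon$ and $\Lambda$.
   Context: All balls and distances in $\mathbb{R}^d$ are with respect to the sup-norm $\|\cdot\|$; $B(\mathbf{x},t)$ is the ball of radius $t$ centered at $\mathbf{x}$. A set $\Lambda\subset\mathbb{R}^d$ is Delone if there are $r,R>0$ such that every ball of radius $r$ contains at most one point of $\Lambda$ and every ball of radius $R$ intersects $\Lambda$. Its packing constant is $r_\Lambda=\inf\{\|\mathbf{x}_1-\mathbf{x}_2\| : \mathbf{x}_1\ne\mathbf{x}_2,\ \mathbf{x}_1,\mathbf{x}_2\in\Lambda\}$. Delone sets are normalized, without loss of generality, to have covering constant $R_\Lambda=\sup_{\mathbf{y}\in\mathbb{R}^d}\inf_{\mathbf{x}\in\Lambda}\|\mathbf{x}-\mathbf{y}\|$ equal to $1$. For $t>0$ and $\mathbf{x}\in\Lambda$, the set $\Lambda\cap B(\mathbf{x},t)$ is the $t$-patch of $\Lambda$ at $\mathbf{x}$. The Hausdorff distance of compact sets $K_1,K_2\subset\mathbb{R}^d$ is $D_H(K_1,K_2)=\inf\{\varepsilon>0: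 K_1\subset K_2^{(+\varepsilon)},\ K_2\subset K_1^{(+\varepsilon)}\}$, where $A^{(+\varepsilon)}=\bigcup_{\mathbf{x}\in A}B(\mathbf{x},\varepsilon)$. $K_1$ is an $\varepsilon$-copy of $K_2$ if it is at Hausdorff distance at most $\varepsilon$ from some translate of $K_2$. For $\varepsilon>0$, $\Lambda$ is $\varepsilon$-linearly repetitive if there is a constant $C_{\rm rep}=C_{\rm rep}(\Lambda,\varepsilon)$ such that for every $r>0$ every $(C_{\rm rep}\cdot r)$-patch of $\Lambda$ contains an $\varepsilon$-copy of every $r$-patch of $\Lambda$; here containing an $\varepsilon$-copy of $\Lambda\cap B(\mathbf{z},r)$ means that the larger ball contains a ball $B(\mathbf{y},r)$ for which $\Lambda\cap B(\mathbf{y},r)$ is an $\varepsilon$-copy of $\Lambda\cap B(\mathbf{z},r)$. A box is a set $B=[a_1,b_1]\times\cdots\times[a_d,b_d]$ with $a_i<b_i$ for all $i$; $\mathrm{vol}(B)$ is its Lebesgue measure and $\ell(B)=\min_i(b_i-a_i)$ its width.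
   Formalization: The assumption ε < r_Λ is replaced by ε < r_Λ/2, and the bound is proved for boxes with ℓ(B) ≥ ℓ₀ for each ℓ₀ > 0, with α depending also on ℓ₀ (μ, δ do not); as printed the claim fails for tiny cubes around a point and for some Λ with r_Λ/2 < ε < r_Λ. *)

(* Defs.v *)
From HB Require Import structures.
From mathcomp Require Import all_boot all_order all_algebra.
From mathcomp Require Import finmap.
From mathcomp Require Import all_classical all_reals all_analysis.

Set Implicit Arguments.
Unset Strict Implicit.
Unset Printing Implicit Defensive.

Import Order.TTheory GRing.Theory Num.Theory.
Import numFieldNormedType.Exports.

Local Open Scope classical_set_scope.
Local Open Scope ring_scope.

(* The norm `|x| on 'rV[R]_d.+1 is the sup-norm. Writing the dimension as d.+1
   makes it at least 1. Balls are closed. *)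
Definition cball (R : realType) (d : nat) (x : 'rV[R]_d.+1) (t : R)
  : set 'rV[R]_d.+1 := closed_ball_ Num.norm x t.

Definition uniformly_discrete (R : realType) (d : nat)
    (L : set 'rV[R]_d.+1) : Prop :=
  exists2 r : R, 0 < r &
    forall y x1 x2, (L `&` cball y r) x1 -> (L `&` cball y r) x2 -> x1 = x2.

Definition relatively_dense (R : realType) (d : nat)
    (L : set 'rV[R]_d.+1) : Prop :=
  exists2 r : R, 0 < r & forall y, L `&` cball y r !=set0.

Definition delone (R : realType) (d : nat) (L : set 'rV[R]_d.+1) : Prop :=
  uniformly_discrete L /\ relatively_dense L.

(* The smallest distance, hence twice the packing radius. Linear repetitivity
   controls the number of points of patches only for eps below half of this
   constant: two points of a patch at distance at most 2 * eps may both be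
   matched, in the Hausdorff distance, to the same point of its eps-copy. *)
Definition packing_constant (R : realType) (d : nat)
    (L : set 'rV[R]_d.+1) : R :=
  inf [set t | exists x1 x2, [/\ L x1, L x2, x1 != x2 & t = `|x1 - x2|]].

Definition patch (R : realType) (d : nat) (L : set 'rV[R]_d.+1)
    (x : 'rV[R]_d.+1) (t : R) : set 'rV[R]_d.+1 := L `&` cball x t.

Definition thickening (R : realType) (d : nat) (A : set 'rV[R]_d.+1) (e : R)
  : set 'rV[R]_d.+1 := \bigcup_(x in A) cball x e.

(* The infimum is taken in \bar R, so that a nonempty set is at distance +oo
   from the empty set; over R, inf set0 would be 0. *)
Definition hausdorff_dist (R : realType) (d : nat)
    (K1 K2 : set 'rV[R]_d.+1) : \bar R :=
  ereal_inf [set e%:E | e in [set e : R |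
    [/\ 0 < e, K1 `<=` thickening K2 e & K2 `<=` thickening K1 e]]].

Definition eps_copy (R : realType) (d : nat) (eps : R)
    (K1 K2 : set 'rV[R]_d.+1) : Prop :=
  exists v : 'rV[R]_d.+1,
    (hausdorff_dist K1 [set (x + v)%R | x in K2] <= eps%:E)%E.

(* The center y of the smaller ball need not belong to L. *)
Definition eps_linearly_repetitive (R : realType) (d : nat)
    (L : set 'rV[R]_d.+1) (eps : R) : Prop :=
  exists2 C : R, 0 < C &
    forall r : R, 0 < r -> forall x z, L x -> L z ->
      exists y, cball y r `<=` cball x (C * r) /\
                eps_copy eps (L `&` cball y r) (patch L z r).

Definition box (R : realType) (d : nat) (a b : 'rV[R]_d.+1)
  : set 'rV[R]_d.+1 := [set x | forall i, a 0 i <= x 0 i <= b 0 i].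

Definition box_vol (R : realType) (d : nat) (a b : 'rV[R]_d.+1) : R :=
  \prod_(i < d.+1) (b 0 i - a 0 i).

(* A discrepancy bound alpha * box_vol / box_width `^ delta with delta < 1
   requires a positive lower bound on box_width: it tends to 0 on the cubes of
   side s -> 0 centered at a point of the set, which contain one point. *)
Definition box_width (R : realType) (d : nat) (a b : 'rV[R]_d.+1) : R :=
  \big[Num.min/b 0 ord0 - a 0 ord0]_(i < d.+1) (b 0 i - a 0 i).

(* fset_set A is empty when A is infinite. The number of points is only used
   for the trace on a bounded set of a Delone set, which is finite. *)
Definition npoints (R : realType) (d : nat) (A : set 'rV[R]_d.+1) : R :=
  (#|` fset_set A|)%:R.

(* (2t)^d.+1 is the volume of the sup-norm ball of radius t. *)
Definition asymptotic_density (R : realType) (d : nat)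
    (L : set 'rV[R]_d.+1) (mu : R) : Prop :=
  npoints (L `&` cball 0 t) / (2 * t) ^+ d.+1 @[t --> +oo] --> mu.

(* Main.v *)
Require Import Defs.
From mathcomp Require Import all_boot all_order all_algebra finmap.
From mathcomp Require Import all_classical all_reals all_analysis.
From mathcomp Require Import ring lra.

(** Half-open boxes make the number of points exactly additive. Suppose that
    the mean densities of all boxes of width at least l lie between m and M.
    By bisection it suffices to look at boxes with sides between l and 2l.
    Either all of these have density at most (m + M) / 2, or one of them is
    denser; then, for a constant K, every box with sides between Kl and 2Kl
    contains an almost identical copy of the dense box, at distance at least l
    from its boundary, and the rest of the large box, a union of boxes of width
    at least l, still has density at least m. In both cases the densities at
    scale Kl fill an interval of length (1 - tau) (M - m) + O(1 / l), which
    therefore decays like a power of l.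

    An eps-copy has at least as many points as the original because 2 eps is
    smaller than the minimal distance. The position of the copied patch relative
    to its ball is never used, only an injection into a slightly larger box. *)

Set Implicit Arguments.
Unset Strict Implicit.
Unset Printing Implicit Defensive.

Import Order.TTheory GRing.Theory Num.Theory.
Import numFieldNormedType.Exports.

Local Open Scope classical_set_scope.
Local Open Scope ring_scope.

(** * Sup-norm and half-open boxes: volume, cuts, bisection *)

Lemma row_norm_leP (R : realType) (d : nat) (x : 'rV[R]_d.+1) (t : R) :
  (forall i, `|x 0 i| <= t) <-> `|x| <= t.
Proof.
split=> [h|h i]; last first.
  apply: le_trans h; rewrite [leRHS]mx_normrE.
  exact: (le_bigmax _ (fun ij : 'I_1 * 'I_d.+1 => `|x ij.1 ij.2|) (0, i)).
rewrite [leLHS]mx_normrE; apply: bigmax_le => [|[i j] _ /=].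
  exact: le_trans (h ord0).
by rewrite ord1.
Qed.

Definition hbox (R : realType) (d : nat) (a b : 'rV[R]_d.+1) :
  set 'rV[R]_d.+1 := [set x | forall i, a 0 i <= x 0 i < b 0 i].

Definition wide (R : realType) (d : nat) (l : R) (a b : 'rV[R]_d.+1) : Prop :=
  forall i, l <= b 0 i - a 0 i.

Definition set_coord (R : realType) (d : nat) (a : 'rV[R]_d.+1)
    (i : 'I_d.+1) (c : R) : 'rV[R]_d.+1 :=
  \row_j (if j == i then c else a 0 j).

Lemma set_coordE (R : realType) (d : nat) (a : 'rV[R]_d.+1) i c j :
  set_coord a i c 0 j = if j == i then c else a 0 j.
Proof. by rewrite mxE. Qed.

Lemma box_vol_ge0 (R : realType) (d : nat) (l : R) (a b : 'rV[R]_d.+1) :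
  0 <= l -> wide l a b -> 0 <= box_vol a b.
Proof. by move=> l0 w; apply: prodr_ge0 => i _; apply: le_trans (w i). Qed.

Lemma box_vol_ge (R : realType) (d : nat) (l : R) (a b : 'rV[R]_d.+1) :
  0 <= l -> wide l a b -> l ^+ d.+1 <= box_vol a b.
Proof.
move=> l0 w; rewrite -[d.+1 in leLHS]card_ord -prodr_const.
by apply: ler_prod => i _; rewrite l0 w.
Qed.

Lemma box_vol_gt0 (R : realType) (d : nat) (l : R) (a b : 'rV[R]_d.+1) :
  0 < l -> wide l a b -> 0 < box_vol a b.
Proof.
by move=> l0 w; apply: lt_le_trans (box_vol_ge (ltW l0) w); apply: exprn_gt0.
Qed.

Lemma box_vol_le (R : realType) (d : nat) (l : R) (a b : 'rV[R]_d.+1) :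
  (forall i, 0 <= b 0 i - a 0 i <= l) -> box_vol a b <= l ^+ d.+1.
Proof.
move=> w; rewrite -[d.+1 in leRHS]card_ord -prodr_const.
exact: ler_prod.
Qed.

Lemma box_vol_split (R : realType) (d : nat) (a b : 'rV[R]_d.+1) i c :
  box_vol a b = box_vol a (set_coord b i c) + box_vol (set_coord a i c) b.
Proof.
rewrite /box_vol (bigD1 i)//= [in X in _ = X + _](bigD1 i)//=.
rewrite [in X in _ = _ + X](bigD1 i)//= !set_coordE eqxx.
rewrite [in RHS](eq_bigr (fun j => b 0 j - a 0 j)); last first.
  by move=> j /negPf ji; rewrite set_coordE ji.
rewrite [in X in _ = _ + X](eq_bigr (fun j => b 0 j - a 0 j)); last first.
  by move=> j /negPf ji; rewrite set_coordE ji.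
by ring.
Qed.

Lemma hbox_split (R : realType) (d : nat) (a b : 'rV[R]_d.+1) i c :
  a 0 i <= c <= b 0 i ->
  hbox a b = hbox a (set_coord b i c) `|` hbox (set_coord a i c) b.
Proof.
move=> /andP[ac cb]; apply/seteqP; split=> [x abx|x].
  have [xc|cx] := ltP (x 0 i) c; [left|right] => j; have := abx j;
    rewrite set_coordE; case: eqP => [->|]//.
    by rewrite xc => /andP[-> _].
  by rewrite cx => /andP[_ ->].
case=> h j; have := h j; rewrite set_coordE; case: eqP => [->|]// /andP[h1 h2].
  by rewrite h1 (lt_le_trans h2).
by rewrite h2 (le_trans ac).
Qed.

Lemma hbox_split_disjoint (R : realType) (d : nat) (a b : 'rV[R]_d.+1) i c :
  hbox a (set_coord b i c) `&` hbox (set_coord a i c) b = set0.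
Proof.
apply/seteqP; split=> // x [/(_ i) + /(_ i)]; rewrite !set_coordE eqxx.
by move=> /andP[_ xc] /andP[cx _]; move: (lt_le_trans xc cx); rewrite ltxx.
Qed.

(* Bisect a side longer than [2 * l]: the volume is halved, and it stays at
   least [l ^+ d.+1]. *)
Lemma wide_box_ind (R : realType) (d : nat) (l : R)
    (Q : 'rV[R]_d.+1 -> 'rV[R]_d.+1 -> Prop) :
  0 < l ->
  (forall a b, wide l a b -> (forall i, b 0 i - a 0 i <= 2 * l) -> Q a b) ->
  (forall (a b : 'rV[R]_d.+1) i c, a 0 i <= c <= b 0 i ->
     Q a (set_coord b i c) -> Q (set_coord a i c) b -> Q a b) ->
  forall a b, wide l a b -> Q a b.
Proof.
move=> l0 Qbase Qglue a b w.
have [n] : exists n, box_vol a b <= 2 ^+ n * l ^+ d.+1.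
  exists (Num.Def.archi_bound (box_vol a b / l ^+ d.+1)).
  by rewrite -ler_pdivrMr ?exprn_gt0//; apply/ltW/upper_nthrootP.
elim: n => [|n IHn] in a b w *; move=> vn.
  apply: Qbase => // i; rewrite leNgt; apply/negP => wi.
  move: vn; rewrite expr0 mul1r leNgt => /negP; apply.
  rewrite exprS /box_vol (bigD1 i)//=.
  have li : l < b 0 i - a 0 i by lra.
  apply: (@lt_le_trans _ _ ((b 0 i - a 0 i) * l ^+ d)).
    by rewrite ltr_pM2r ?exprn_gt0.
  rewrite ler_pM2l ?(lt_trans l0)//.
  have -> : l ^+ d = \prod_(j < d.+1 | j != i) l.
    by rewrite prodr_const cardC1 card_ord.
  by apply: ler_prod => j _; rewrite (ltW l0) w.
have [/forallP h|] := boolP [forall i, b 0 i - a 0 i <= 2 * l].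
  exact: Qbase.
rewrite negb_forall => /existsP[i]; rewrite -ltNge => wi.
set c := (a 0 i + b 0 i) / 2.
have acb : a 0 i <= c <= b 0 i by apply/andP; split; rewrite /c; lra.
have w1 : wide l a (set_coord b i c).
  by move=> j; rewrite set_coordE; case: eqP => [->|_ //]; rewrite /c; lra.
have w2 : wide l (set_coord a i c) b.
  by move=> j; rewrite set_coordE; case: eqP => [->|_ //]; rewrite /c; lra.
have vE : box_vol a (set_coord b i c) = box_vol (set_coord a i c) b.
  rewrite /box_vol (bigD1 i)//= [RHS](bigD1 i)//= !set_coordE eqxx.
  congr (_ * _); first by rewrite /c; lra.
  by apply: eq_bigr => j /negPf ji; rewrite !set_coordE ji.
have vS := box_vol_split a b i c.
rewrite exprS in vn.
by apply: (Qglue _ _ _ _ acb); apply: IHn => //; lra.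
Qed.

(** * Counting the points of a separated set in half-open boxes *)

Lemma finite_hbox (R : realType) (d : nat) (L : set 'rV[R]_d.+1) (s : R)
    (a b : 'rV[R]_d.+1) :
  0 < s -> (forall x y, L x -> L y -> `|x - y| < s -> x = y) ->
  finite_set (L `&` hbox a b).
Proof.
move=> s0 Ls.
suff fin (b' : 'rV[R]_d.+1) : wide (s / 4) a b' -> finite_set (L `&` hbox a b').
  (* The given box may be thin or empty, so its upper corner is raised to make it [wide (s / 4)], as
     bisection requires. The final cells have sides at most [s / 2] and hold at most one point. *)
  apply: (@sub_finite_set _ _ (L `&` hbox a
      (\row_i Num.max (b 0 i) (a 0 i + s / 4)))).
    move=> x [Lx abx]; split=> // i; have /andP[-> xb] := abx i.
    by rewrite mxE lt_max xb.
  by apply: fin => i; rewrite mxE lerBrDl le_max lexx orbT.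
move: b' => b'.
apply: (@wide_box_ind _ _ _ (fun a b => finite_set (L `&` hbox a b))).
- by lra.
- move=> {}a {}b _ ab;
  have [->//|/set0P[x [Lx abx]]] := eqVneq (L `&` hbox a b) set0.
  apply: (sub_finite_set _ (finite_set1 x)) => y [Ly aby]; apply: Ls => //.
  apply: (@le_lt_trans _ _ (s / 2)); last by lra.
  apply/row_norm_leP => i; rewrite !mxE.
  have /andP[? ?] := abx i; have /andP[? ?] := aby i; have := ab i.
  by move=> ?; rewrite ler_norml; apply/andP; split; lra.
- move=> {}a {}b i c acb f1 f2; rewrite (hbox_split acb) setIUr.
  by rewrite finite_setU.
Qed.

Lemma npoints_le (R : realType) (d : nat) (A B : set 'rV[R]_d.+1)
    (f : 'rV[R]_d.+1 -> 'rV[R]_d.+1) :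
  finite_set A -> finite_set B ->
  (forall x, A x -> B (f x)) ->
  (forall x y, A x -> A y -> f x = f y -> x = y) ->
  npoints A <= npoints B.
Proof.
move=> finA finB AB finj; rewrite /npoints ler_nat.
have <- : #|` (f @` fset_set A)%fset| = #|` fset_set A|.
  apply/eqP/card_in_imfsetP => x y; rewrite !in_fset_set// !inE.
  exact: finj.
apply: fsubset_leq_card; apply/fsubsetP => _ /imfsetP[x /= + ->].
by rewrite !in_fset_set// !inE => /AB.
Qed.

Lemma npointsU (R : realType) (d : nat) (A B : set 'rV[R]_d.+1) :
  finite_set A -> finite_set B -> A `&` B = set0 ->
  npoints (A `|` B) = npoints A + npoints B.
Proof.
move=> finA finB AB; rewrite /npoints fset_setU// -natrD; congr _%:R; apply/eqP.
rewrite leq_card_fsetU; apply/fdisjointP => x; rewrite !in_fset_set// !inE.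
move=> Ax; apply/negP; rewrite inE => Bx.
by have : (A `&` B) x by []; rewrite AB.
Qed.

Definition uniformly_separated (R : realType) (d : nat)
    (L : set 'rV[R]_d.+1) (s : R) : Prop :=
  forall x y, L x -> L y -> `|x - y| < s -> x = y.

Definition hpoints (R : realType) (d : nat) (L : set 'rV[R]_d.+1)
  (a b : 'rV[R]_d.+1) : R := npoints (L `&` hbox a b).

Definition density_ge (R : realType) (d : nat) (L : set 'rV[R]_d.+1)
    (l m : R) : Prop :=
  forall a b, wide l a b -> m * box_vol a b <= hpoints L a b.

Definition density_le (R : realType) (d : nat) (L : set 'rV[R]_d.+1)
    (l m : R) : Prop :=
  forall a b, wide l a b -> hpoints L a b <= m * box_vol a b.

Lemma wideW (R : realType) (d : nat) (l l' : R) (a b : 'rV[R]_d.+1) :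
  l <= l' -> wide l' a b -> wide l a b.
Proof. by move=> ll w i; apply: le_trans (w i). Qed.

Lemma separated_packing (R : realType) (d : nat) (L : set 'rV[R]_d.+1) :
  uniformly_separated L (packing_constant L).
Proof.
move=> x y Lx Ly; apply: contraPP => /eqP xy; apply/negP; rewrite -leNgt.
apply: ge_inf; last by exists x, y.
by exists 0 => _ [? [? [_ _ _ ->]]].
Qed.

Section Counting.
Context (R : realType) (d : nat) (L : set 'rV[R]_d.+1) (s : R)
  (s0 : 0 < s) (Ls : uniformly_separated L s).

Lemma hpoints_split (a b : 'rV[R]_d.+1) i c : a 0 i <= c <= b 0 i ->
  hpoints L a b = hpoints L a (set_coord b i c) + hpoints L (set_coord a i c) b.
Proof.
move=> acb; rewrite /hpoints (hbox_split acb) setIUr npointsU//.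
- exact: finite_hbox Ls.
- exact: finite_hbox Ls.
- by rewrite setIACA hbox_split_disjoint setI0.
Qed.

(** The count and the volume are both additive under a cut, so a density bound on the cells of a
    bisection passes to the whole box. *)
Lemma density_ge_box (l m : R) : 0 < l ->
  (forall a b, wide l a b -> (forall i, b 0 i - a 0 i <= 2 * l) ->
     m * box_vol a b <= hpoints L a b) -> density_ge L l m.
Proof.
move=> l0 h.
apply: (wide_box_ind (Q := fun a b => m * box_vol a b <= hpoints L a b) l0 h).
move=> a b i c acb.
by rewrite (box_vol_split a b i c) (hpoints_split acb) mulrDr; apply: lerD.
Qed.

Lemma density_le_box (l m : R) : 0 < l ->
  (forall a b, wide l a b -> (forall i, b 0 i - a 0 i <= 2 * l) ->
     hpoints L a b <= m * box_vol a b) -> density_le L l m.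
Proof.
move=> l0 h.
apply: (wide_box_ind (Q := fun a b => hpoints L a b <= m * box_vol a b) l0 h).
move=> a b i c acb.
by rewrite (box_vol_split a b i c) (hpoints_split acb) mulrDr; apply: lerD.
Qed.

(** Bisect down to cells with sides between [t] and [2 * t], where [t <= s / 4]: each holds at most
    one point and has volume at least [t ^+ d.+1]. *)
Lemma density_le_exists (l : R) : 0 < l ->
  exists2 M, 0 < M & density_le L l M.
Proof.
move=> l0; set t := Num.min l (s / 4).
have t0 : 0 < t by rewrite lt_min l0 divr_gt0.
have tl : t <= l by rewrite ge_min lexx.
have ts : t <= s / 4 by rewrite ge_min lexx orbT.
exists (t ^+ d.+1)^-1; first by rewrite invr_gt0 exprn_gt0.
suff h : density_le L t (t ^+ d.+1)^-1 by move=> a b w; apply/h/(wideW tl).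
apply: density_le_box => // a b w ab.
apply: (@le_trans _ _ 1); last first.
  rewrite mulrC ler_pdivlMr ?exprn_gt0// mul1r.
  exact: box_vol_ge (ltW t0) w.
rewrite /hpoints.
have [->|/set0P[x [Lx abx]]] := eqVneq (L `&` hbox a b) set0.
  by rewrite /npoints fset_set0 cardfs0.
have -> : 1 = npoints [set x] by rewrite /npoints fset_set1 cardfs1.
apply: (npoints_le (f := id)) => //; first exact: finite_hbox Ls.
move=> y [Ly aby]; apply: Ls => //; apply: (@le_lt_trans _ _ (s / 2)).
  apply/row_norm_leP => i; rewrite !mxE.
  have /andP[? ?] := abx i; have /andP[? ?] := aby i; have := ab i.
  by move=> ?; rewrite ler_norml; apply/andP; split; lra.
by have := s0; lra.
Qed.

(* Peel off, one coordinate at a time, the slabs on both sides of the inner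
   box: each of them is wide. *)
Lemma hpoints_inner_box (l m : R) (a b a' b' : 'rV[R]_d.+1) :
  0 <= l -> density_ge L l m -> wide l a' b' ->
  (forall i, a 0 i + l <= a' 0 i) -> (forall i, b' 0 i + l <= b 0 i) ->
  hpoints L a' b' - m * box_vol a' b' <= hpoints L a b - m * box_vol a b.
Proof.
move=> l0 hm w' aa' bb'.
(* Corners that agree with the inner box in the first [k] coordinates and with the outer box in the
   others. *)
pose h k (x x' : 'rV[R]_d.+1) : 'rV[R]_d.+1 :=
  \row_i (if (i < k)%N then x' 0 i else x 0 i).
(* The excess over density [m] is additive under cuts and nonnegative on wide boxes, so discarding
   wide slabs can only lower it. *)
pose F x y := hpoints L x y - m * box_vol x y.
have F0 x y : wide l x y -> 0 <= F x y by move=> w; rewrite subr_ge0 hm.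
have Fsplit (x y : 'rV[R]_d.+1) i c : x 0 i <= c <= y 0 i ->
    F x y = F x (set_coord y i c) + F (set_coord x i c) y.
  by move=> xy; rewrite /F (hpoints_split xy) (box_vol_split x y i c); ring.
suff hk k : (k <= d.+1)%N -> F (h k a a') (h k b b') <= F a b.
  have hE x x' : h d.+1 x x' = x' by apply/rowP => i; rewrite mxE ltn_ord.
  by have := hk _ (leqnn _); rewrite !hE.
elim: k => [_|k IHk kd].
  have hE x x' : h 0 x x' = x by apply/rowP => i; rewrite mxE.
  by rewrite !hE.
apply: le_trans (IHk (ltnW kd)).
have hS x x' :
    h k.+1 x x' = set_coord (h k x x') (Ordinal kd) (x' 0 (Ordinal kd)).
  apply/rowP => j; rewrite set_coordE !mxE ltnS leq_eqVlt -(inj_eq val_inj)/=.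
  by case: eqP => //= jk; congr (x' 0 _); apply: val_inj.
have hj x x' (j : 'I_d.+1) : h k x x' 0 j = if (j < k)%N then x' 0 j else x 0 j.
  by rewrite mxE.
set i := Ordinal kd in hS.
have hi x x' : h k x x' 0 i = x 0 i by rewrite hj ltnn.
have wh : wide l (h k a a') (h k b b').
  move=> j; rewrite !hj; case: ifP => _; first exact: w'.
  by move: (aa' j) (bb' j) (w' j); lra.
have [[ai bi] wi] := (aa' i, bb' i, w' i).
rewrite !hS (Fsplit (h k a a') _ i (a' 0 i)); last by rewrite !hi; lra.
rewrite (Fsplit _ (h k b b') i (b' 0 i)); last first.
  by rewrite set_coordE eqxx hi; lra.
set A := F _ _; set B := F _ _; set C := F _ _.
suff [A0 C0] : 0 <= B /\ 0 <= C by lra.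
split; apply: F0 => j; rewrite !set_coordE; case: eqP => [->|_] //; rewrite ?hi;
  by lra.
Qed.

End Counting.

(** * From repetitivity to a contraction of the density gap *)

Lemma repetitive_matching (R : realType) (d : nat) (L : set 'rV[R]_d.+1)
    (eps e : R) : eps_linearly_repetitive L eps -> eps < e ->
  exists2 C, 0 < C & forall r x z, 0 < r -> L x -> L z ->
    exists v f, forall u, L u -> `|z - u| <= r ->
      [/\ L (f u), `|x - f u| <= C * r & `|u + v - f u| <= e].
Proof.
move=> [C C0 hC] epse; exists C => // r x z r0 Lx Lz.
have [y [yx [v hd]]] := hC r r0 x z Lx Lz; exists v.
(* The infimum defining the Hausdorff distance may not be attained; the room between [eps] and [e]
   yields an admissible [e1 < e]. The translated patch then lies in the [e1]-thickening of the copy,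
   and choosing a nearby point for each [u] gives [f]. *)
have /(le_lt_trans hd)/ereal_inf_lt[_ [e1 [_ _ sub] <-]] : (eps%:E < e%:E)%E.
  by rewrite lte_fin.
rewrite lte_fin => e1e.
suff h u : exists w, L u -> `|z - u| <= r ->
    [/\ L w, `|x - w| <= C * r & `|u + v - w| <= e].
  by have [f hf] := choice h; exists f.
have [[Lu uz]|nu] := pselect (L u /\ `|z - u| <= r); last first.
  by exists u => Lu uz; case: nu.
have [|w [Lw wy] wuv] := sub (u + v); first by exists u.
exists w => _ _; split=> //; first exact: yx.
by rewrite distrC; apply: le_trans (ltW e1e).
Qed.

(** By convexity the power lies below its chord on the unit interval, whose slope [2 ^+ n - 1] is
    what the induction carries. *)
Lemma exprD1_le (R : realType) (t : R) n : 0 <= t <= 1 ->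
  (1 + t) ^+ n <= 1 + 2 ^+ n * t.
Proof.
move=> /andP[t0 t1]; suff : (1 + t) ^+ n <= 1 + (2 ^+ n - 1) * t by lra.
elim: n => [|n IHn]; first by rewrite !expr0; lra.
have p1 : 1 <= (2 : R) ^+ n by rewrite exprn_ege1// ler1n.
rewrite !exprS; apply: (@le_trans _ _ ((1 + t) * (1 + (2 ^+ n - 1) * t))).
  by rewrite ler_wpM2l//; lra.
have : 0 <= (2 ^+ n - 1) * (t * (1 - t)) by rewrite !mulr_ge0// subr_ge0.
by lra.
Qed.

(** Each side is at least [l], so adding [h] multiplies it by at most [1 + h / l]. *)
Lemma box_vol_enlarge (R : realType) (d : nat) (l h : R)
    (a b a' b' : 'rV[R]_d.+1) :
  0 < l -> 0 <= h <= l -> wide l a b ->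
  (forall i, b' 0 i - a' 0 i = b 0 i - a 0 i + h) ->
  box_vol a' b' <= (1 + 2 ^+ d.+1 * (h / l)) * box_vol a b.
Proof.
move=> l0 /andP[h0 hl] w side.
have t01 : 0 <= h / l <= 1 by rewrite divr_ge0 ?(ltW l0)//= ler_pdivrMr ?mul1r.
apply: (@le_trans _ _ ((1 + h / l) ^+ d.+1 * box_vol a b)); last first.
  by rewrite ler_wpM2r ?exprD1_le// (box_vol_ge0 (ltW l0)).
rewrite -[d.+1 in leRHS]card_ord -prodr_const -big_split/=.
apply: ler_prod => i _; rewrite side; have := w i => wi.
apply/andP; split; first by lra.
suff : h <= h / l * (b 0 i - a 0 i) by lra.
by rewrite mulrAC -mulrA ler_peMr// ler_pdivlMr ?mul1r.
Qed.

Section Contraction.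
Context (R : realType) (d : nat) (L : set 'rV[R]_d.+1) (s e rho C : R)
  (s0 : 0 < s) (Ls : uniformly_separated L s) (e0 : 0 <= e) (es : 2 * e < s)
  (Lrho : forall y, exists2 x, L x & `|y - x| <= rho) (C0 : 0 < C)
  (matching : forall r x z, 0 < r -> L x -> L z ->
    exists v f, forall u, L u -> `|z - u| <= r ->
      [/\ L (f u), `|x - f u| <= C * r & `|u + v - f u| <= e]).

(* The copy produced by [exists_copy] lies within [(2 * C + 5) * l] of the
   center of the large box, and [K / 2 = (2 * C + 5) + 1] leaves a margin
   [l]. *)
Let K := 4 * C + 12.
(** A box with sides at least [l] fills at least this fraction of a box with sides at most
    [2 * K * l]. *)
Let theta := (2 * K) ^- d.+1.

Lemma exists_copy (l : R) (a b p q : 'rV[R]_d.+1) :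
  2 * rho < l -> 2 * e <= l -> 0 < l ->
  wide (K * l) a b -> wide l p q -> (forall i, q 0 i - p 0 i <= 2 * l) ->
  exists p' q', [/\ hpoints L p q <= hpoints L p' q',
    forall i, q' 0 i - p' 0 i = q 0 i - p 0 i + 2 * e,
    forall i, a 0 i + l <= p' 0 i & forall i, q' 0 i + l <= b 0 i].
Proof.
move=> rl el l0 wab wpq pq.
have mid_le (x y z : 'rV[R]_d.+1) i : `|2^-1 *: (x + y) - z| <= rho ->
    (x 0 i + y 0 i) / 2 - rho <= z 0 i <= (x 0 i + y 0 i) / 2 + rho.
  move=> /row_norm_leP/(_ i); rewrite !mxE ler_norml; lra.
(* Patches are centered at points of [L], so the centers of the two boxes are replaced by points of
   [L] within [rho] of them. *)
have [z Lz /mid_le zpq] := Lrho (2^-1 *: (p + q)).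
have [x Lx /mid_le xab] := Lrho (2^-1 *: (a + b)).
have [|v [f fP]] := matching (r := 2 * l) _ Lx Lz; first by rewrite mulr_gt0.
have uz u : hbox p q u -> `|z - u| <= 2 * l.
  move=> pqu; apply/row_norm_leP => i; rewrite !mxE ler_norml.
  by have := zpq i; have := pqu i; have := pq i; have := wpq i; lra.
pose p' : 'rV[R]_d.+1 := \row_i (p 0 i + v 0 i - e).
pose q' : 'rV[R]_d.+1 := \row_i (q 0 i + v 0 i + e).
have near_copy (u : 'rV[R]_d.+1) i : L u -> `|z - u| <= 2 * l ->
    u 0 i + v 0 i - e <= f u 0 i <= u 0 i + v 0 i + e /\
    x 0 i - C * (2 * l) <= f u 0 i <= x 0 i + C * (2 * l).
  move=> Lu /(fP _ Lu)[_ /row_norm_leP/(_ i) + /row_norm_leP/(_ i)].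
  by rewrite !mxE !ler_norml; lra.
(* Applied to [z] itself, the matching locates the translation: [z + v] is within [e] of [f z],
   which is within [C * (2 * l)] of [x]. *)
have [z1 z2] : (forall i, z 0 i + v 0 i - e <= f z 0 i <= z 0 i + v 0 i + e) /\
    (forall i, x 0 i - C * (2 * l) <= f z 0 i <= x 0 i + C * (2 * l)).
  have zz : `|z - z| <= 2 * l by rewrite subrr normr0 mulr_ge0// ltW.
  by split=> i; have [] := near_copy z i Lz zz.
exists p', q'; split.
- apply: (npoints_le (f := f)); [exact: finite_hbox Ls|exact: finite_hbox Ls| |].
    move=> u [Lu pqu]; have [Lfu _ _] := fP _ Lu (uz _ pqu).
    split=> // i; have [+ _] := near_copy _ i Lu (uz _ pqu).
    by have := pqu i; rewrite !mxE; lra.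
  move=> u1 u2 [Lu1 /uz h1] [Lu2 /uz h2] fu; apply: Ls => //.
  have [_ _ d1] := fP _ Lu1 h1; have [_ _ d2] := fP _ Lu2 h2.
  (* Injectivity: two points with the same image are at distance at most [2 * e], which is below the
     separation [s]. *)
  have -> : u1 - u2 = (u1 + v - f u1) - (u2 + v - f u2).
    by rewrite fu !opprB opprD; apply/rowP => i; rewrite !mxE; ring.
  by apply: le_lt_trans (ler_normB _ _) _; have := es; lra.
- by move=> i; rewrite !mxE; lra.
- move=> i; rewrite !mxE.
  move: (zpq i) (xab i) (z1 i) (z2 i) (wpq i) (wab i) (pq i); rewrite /K; nra.
- move=> i; rewrite !mxE.
  move: (zpq i) (xab i) (z1 i) (z2 i) (wpq i) (wab i) (pq i); rewrite /K; nra.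
Qed.

(** The copy has volume [v'] and excess over density [m] at least [(mid - m) * v - m * (v' - v)],
    and [hpoints_inner_box] passes this excess to the large box. The bounds [theta * V <= v <= V]
    make it a proportion of [V]; the last term pays for the enlargement by [e]. *)
Lemma lower_density_improve (l m M0 mid : R) (p q : 'rV[R]_d.+1) :
  2 * rho < l -> 2 * e <= l -> 0 < l ->
  0 <= m -> m <= M0 -> m <= mid -> density_ge L l m ->
  wide l p q -> (forall i, q 0 i - p 0 i <= 2 * l) ->
  mid * box_vol p q <= hpoints L p q ->
  density_ge L (K * l) (m + theta * (mid - m) - 2 ^+ d.+1 * (2 * e) * M0 / l).
Proof.
move=> rl el l0 m0 mM0 mmid hm wpq pq hpq.
have K0 : 0 < K by rewrite /K; have := C0; lra.
apply: (density_ge_box s0 Ls); first by rewrite mulr_gt0.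
move=> a b wab ab.
have [p' [q' [cnt side lo hi]]] := exists_copy rl el l0 wab wpq pq.
have w' : wide l p' q'.
  by move=> i; rewrite side; have := wpq i; have := e0; lra.
have := hpoints_inner_box s0 Ls (ltW l0) hm w' lo hi.
set V := box_vol a b; set v := box_vol p q; set v' := box_vol p' q' => inner.
have v0 : 0 < v by exact: box_vol_gt0 wpq.
have e20 : 0 <= 2 * e by rewrite mulr_ge0.
have v'v : v' <= (1 + 2 ^+ d.+1 * (2 * e / l)) * v.
  by apply: box_vol_enlarge side => //; rewrite e20.
have Vv : theta * V <= v.
  rewrite /theta mulrC ler_pdivrMr ?exprn_gt0 ?mulr_gt0//.
  apply: (@le_trans _ _ ((2 * (K * l)) ^+ d.+1)).
    apply: box_vol_le => i; rewrite ab andbT.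
    by apply: le_trans (wab i); rewrite mulr_ge0 ?ltW.
  by rewrite mulrA [leRHS]mulrC exprMn ler_pM2l ?exprn_gt0 ?mulr_gt0//
    (box_vol_ge (ltW l0)).
have vV : v <= V.
  apply: (@le_trans _ _ ((K * l) ^+ d.+1)); last first.
    by apply: box_vol_ge wab; rewrite mulr_ge0 ?ltW.
  apply: box_vol_le => i; apply/andP; split.
    by apply: le_trans (wpq i); apply: ltW.
  by apply: le_trans (pq i) _; rewrite ler_pM2r// /K; have := C0; lra.
set T := 2 ^+ d.+1 * (2 * e / l) in v'v.
have T0 : 0 <= T by rewrite mulr_ge0 ?exprn_ge0 ?divr_ge0 ?(ltW l0).
have -> : 2 ^+ d.+1 * (2 * e) * M0 / l = T * M0 by rewrite /T; ring.
have h1 : m * v' <= m * v + T * M0 * V.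
  apply: (@le_trans _ _ (m * v + m * (T * v))).
    by rewrite -mulrDr ler_wpM2l//; lra.
  rewrite lerD2l mulrCA -mulrA ler_wpM2l//.
  by apply: ler_pM => //; apply: ltW.
have h2 : (mid - m) * (theta * V) <= (mid - m) * v.
  by rewrite ler_wpM2l// subr_ge0.
by rewrite -/v in hpq; lra.
Qed.

(** The bound [M0] is kept fixed from scale to scale, so that the errors are uniformly of order
    [1 / l]. *)
Lemma density_gap_contract (l m M M0 : R) :
  2 * rho < l -> 2 * e <= l -> 0 < l ->
  0 <= m -> m <= M -> M <= M0 -> density_ge L l m -> density_le L l M ->
  exists m' M', [/\ 0 <= m', M' <= M0,
    density_ge L (K * l) m', density_le L (K * l) M' &
    M' - m' <= (1 - theta / 2) * (M - m) + 2 ^+ d.+1 * (2 * e) * M0 / l].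
Proof.
move=> rl el l0 m0 mM MM0 hm hM.
have K1 : 1 <= K by rewrite /K; have := C0; lra.
have lK : l <= K * l by rewrite ler_peMl// ltW.
have th1 : theta <= 1.
  by rewrite /theta invf_le1 ?exprn_gt0 ?exprn_ege1//; lra.
pose mid := (m + M) / 2.
have E0 : 0 <= 2 ^+ d.+1 * (2 * e) * M0 / l.
  have M00 : 0 <= M0 by lra.
  by rewrite divr_ge0 ?(ltW l0)// !mulr_ge0 ?exprn_ge0.
have [[p [q [wpq pq hpq]]]|no] := pselect (exists p q : 'rV[R]_d.+1,
    [/\ wide l p q, forall i, q 0 i - p 0 i <= 2 * l &
        mid * box_vol p q <= hpoints L p q]).
- have mm : m <= mid by rewrite /mid; lra.
  have := lower_density_improve rl el l0 m0 (le_trans mM MM0) mm hm wpq pq hpq.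
  set m' := _ - _ => hm'.
  (* The error term may push [m'] below [m] or below 0; the maximum remains a valid nonnegative
     lower density. *)
  exists (Num.max m m'), M; split=> //; first by rewrite le_max m0.
  + have [_|_] := leP m m'; first exact: hm'.
    by move=> a b w; apply/hm/(wideW lK).
  + by move=> a b w; apply/hM/(wideW lK).
  + have : m' <= Num.max m m' by rewrite le_max lexx orbT.
    by rewrite /m' /mid; lra.
(* Here the gap is halved, and [theta <= 1] makes this at least as good as the factor
   [1 - theta / 2]. *)
- exists m, mid; split=> //; first by rewrite /mid; lra.
  + by move=> a b w; apply/hm/(wideW lK).
  + suff h : density_le L l mid by move=> a b w; apply/h/(wideW lK).
    apply: (density_le_box s0 Ls) => // p q wpq pq.
    rewrite leNgt; apply/negP => hpq.
    by apply: no; exists p, q; split=> //; apply: ltW.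
  + by rewrite /mid; nra.
Qed.

End Contraction.

(** * Iteration over the scales [K ^+ k * l0] *)

Lemma density_ge_le (R : realType) (d : nat) (L : set 'rV[R]_d.+1)
    (l l' m M : R) :
  0 < l -> density_ge L l m -> density_le L l' M -> m <= M.
Proof.
move=> l0 hm hM; set k := Num.max l l'.
have w : wide k 0 (const_mx k : 'rV[R]_d.+1) by move=> i; rewrite !mxE subr0.
have k0 : 0 < k by rewrite lt_max l0.
have := le_trans (hm _ _ (wideW _ w)) (hM _ _ (wideW _ w)).
by rewrite !le_max !lexx orbT ler_pM2r ?(box_vol_gt0 k0 w)//; apply.
Qed.

(** Half of the contraction is given up to absorb the errors: they decay at rate
    [1 / K <= 1 / 2 <= 1 - tau / 2], and [A] is large enough that [E <= A * (tau / 2)]. *)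
Lemma geometric_decay (R : realType) (K tau E : R) (g : nat -> R -> Prop)
    (g0 : R) :
  2 <= K -> 0 < tau -> tau <= 1 -> 0 <= E -> 0 <= g0 -> g 0 g0 ->
  (forall k x y, x <= y -> g k x -> g k y) ->
  (forall k x, g k x -> g k.+1 ((1 - tau) * x + E / K ^+ k)) ->
  exists2 A, 0 <= A & forall k, g k (A * (1 - tau / 2) ^+ k).
Proof.
move=> K2 t0 t1 E0 g00 gg0 gle gS; pose A := g0 + 2 * E / tau.
have A0 : 0 <= A by rewrite addr_ge0// divr_ge0 ?mulr_ge0// ltW.
exists A => //; elim=> [|k IHk].
  by apply: gle gg0; rewrite mulr1 lerDl divr_ge0 ?mulr_ge0// ltW.
apply: gle (gS _ _ IHk).
have Kk : (K ^+ k)^-1 <= (1 - tau / 2) ^+ k.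
  rewrite -exprVn lerXn2r ?nnegrE ?invr_ge0//; [lra|lra|].
  by apply: (@le_trans _ _ 2^-1); [rewrite lef_pV2 ?posrE; lra|lra].
set r := (1 - tau / 2) ^+ k in Kk *.
have r0 : 0 <= r by rewrite exprn_ge0//; lra.
have EA : E <= A * (tau / 2).
  rewrite mulrDl;
  have -> : 2 * E / tau * (tau / 2) = E by field; rewrite gt_eqF.
  by rewrite lerDr mulr_ge0// divr_ge0// ltW.
have h1 : E / K ^+ k <= E * r by rewrite ler_wpM2l.
have h2 : E * r <= A * (tau / 2) * r by rewrite ler_wpM2r.
by rewrite exprS -/r; lra.
Qed.

Lemma density_gap_decay (R : realType) (d : nat) (L : set 'rV[R]_d.+1)
    (eps : R) : delone L -> 0 < eps -> eps < packing_constant L / 2 ->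
  eps_linearly_repetitive L eps ->
  exists l0 K tau A : R,
    [/\ [/\ 0 < l0, 12 < K, 0 < tau, tau <= 1/2 & 0 <= A] &
    forall k, exists m M, [/\ density_ge L (K ^+ k * l0) m,
      density_le L (K ^+ k * l0) M & M - m <= A * (1 - tau / 2) ^+ k]].
Proof.
move=> [_ [rho rho0 dense]] eps0 eps_lt hrep.
pose s := packing_constant L.
have s0 : 0 < s by rewrite /s; lra.
have Ls : uniformly_separated L s := @separated_packing _ _ L.
have [e [e0 es epse]] : exists e, [/\ 0 <= e, 2 * e < s & eps < e].
  (* The midpoint of [eps] and [s / 2] leaves room on both sides. *)
  by exists ((eps + s / 2) / 2); rewrite /s; split; lra.
have [C C0 matching] := repetitive_matching hrep epse.
have Lrho y : exists2 x, L x & `|y - x| <= rho.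
  by have [x [Lx yx]] := dense y; exists x.
pose K := 4 * C + 12; pose theta := (2 * K) ^- d.+1.
(* Large enough for the contraction step to apply at [l0], hence at every later scale. *)
pose l0 := 2 * rho + 2 * e + 1.
have l00 : 0 < l0 by rewrite /l0; lra.
have [M0 M00 hM0] := density_le_exists s0 Ls l00.
have K12 : 12 < K by rewrite /K; lra.
have th0 : 0 < theta by rewrite invr_gt0 exprn_gt0//; lra.
have th1 : theta <= 1.
  by rewrite /theta invf_le1 ?exprn_gt0 ?exprn_ege1//; lra.
pose g k x := exists m M, [/\ 0 <= m, M <= M0, density_ge L (K ^+ k * l0) m,
      density_le L (K ^+ k * l0) M & M - m <= x].
have [||||||||A A0 hA] := @geometric_decay R K (theta / 2)
    (2 ^+ d.+1 * (2 * e) * M0 / l0) g M0; try lra.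
- by rewrite divr_ge0 ?(ltW l00)// !mulr_ge0 ?exprn_ge0 ?(ltW M00).
- exists 0, M0; rewrite expr0 mul1r; split=> //; last by rewrite subr0.
  move=> a b w; rewrite mul0r /hpoints /npoints; exact: ler0n.
- move=> k x y xy [m [M [? ? ? ? h]]]; exists m, M; split=> //.
  exact: le_trans xy.
- move=> k x [m [M [m0 MM0 hm hM Mm]]].
  have Kk1 : 1 <= K ^+ k by rewrite exprn_ege1//; lra.
  have lk : l0 <= K ^+ k * l0 by rewrite ler_peMl// ltW.
  have lk0 : 0 < K ^+ k * l0 by apply: lt_le_trans lk.
  have rl : 2 * rho < K ^+ k * l0 by apply: lt_le_trans lk; rewrite /l0; lra.
  have el : 2 * e <= K ^+ k * l0 by apply: le_trans lk; rewrite /l0; lra.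
  have mM := density_ge_le lk0 hm hM.
  have [m' [M' [m'0 M'M0 hm' hM' gap]]] := density_gap_contract s0 Ls e0 es
    Lrho C0 matching rl el lk0 m0 mM MM0 hm hM.
  exists m', M'; rewrite exprS -mulrA; split=> //; apply: le_trans gap _.
  have -> y : y / l0 / K ^+ k = y / (K ^+ k * l0) by rewrite invfM; ring.
  rewrite -/K -/theta lerD2r.
  by rewrite ler_wpM2l//; lra.
- exists l0, K, (theta / 2), A; split; first by split=> //; lra.
  by move=> k; have [m [M [_ _ ? ? ?]]] := hA k; exists m, M.
Qed.

(** * Power-law discrepancy for half-open boxes *)

Lemma expr_bracket (R : realType) (K l0 l : R) :
  2 <= K -> 0 < l0 -> l0 <= l ->
  exists k, K ^+ k * l0 <= l < K ^+ k.+1 * l0.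
Proof.
move=> K2 l00 l0l.
have : exists n, l < K ^+ n * l0.
  exists (Num.Def.archi_bound (l / l0)); rewrite -ltr_pdivrMr//.
  apply: lt_le_trans (upper_nthrootP (leqnn _)) _.
  by rewrite lerXn2r ?nnegrE//; lra.
case=> n; elim: n => [|n IHn]; first by rewrite mul1r ltNge l0l.
by have [/IHn//|nl ln] := ltP l (K ^+ n * l0); exists n; rewrite nl.
Qed.

Lemma hbox_discrepancy (R : realType) (d : nat) (L : set 'rV[R]_d.+1)
    (eps : R) : delone L -> 0 < eps -> eps < packing_constant L / 2 ->
  eps_linearly_repetitive L eps ->
  exists mu delta : R, [/\ 0 < delta, delta < 1 / 2 &
    forall l1, 0 < l1 -> exists2 alpha, 0 < alpha &
      forall a b l, l1 <= l -> wide l a b ->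
        `|hpoints L a b - mu * box_vol a b|
          <= alpha / l `^ delta * box_vol a b].
Proof.
move=> hL eps0 eps_lt hrep.
have s0 : 0 < packing_constant L by lra.
have Ls := @separated_packing _ _ L.
have [l0 [K [tau [A [[l00 K12 t0 t1 A0] gap]]]]] :=
  density_gap_decay hL eps0 eps_lt hrep.
pose rho := 1 - tau / 2.
have rho0 : 0 < rho by rewrite /rho; lra.
have lnK0 : 0 < ln K by rewrite ln_gt0//; lra.
pose delta := - ln rho / ln K.
have dK : delta * ln K = - ln rho by rewrite divfK// gt_eqF.
have Kd : K `^ delta = rho^-1.
  by rewrite /powR gt_eqF ?dK ?expRN ?lnK ?posrE//; lra.
have d0 : 0 < delta.
  by rewrite divr_gt0// oppr_gt0 ln_lt0// rho0/= /rho; lra.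
have d12 : delta < 1 / 2.
  rewrite ltr_pdivrMr//.
  (* Since [tau <= 1 / 2], [rho^-1 < 2], and its square is less than 4, well below [K]. *)
  suff : ln (rho ^-1 ^+ 2) < ln K by rewrite lnXn ?invr_gt0// lnV ?posrE//; lra.
  rewrite ltr_ln ?posrE ?exprn_gt0 ?invr_gt0//; last by lra.
  apply: (@lt_trans _ _ (2 ^+ 2)); last by lra.
  rewrite ltrXn2r// ?nnegrE ?invr_ge0 ?(ltW rho0)//.
  by rewrite invf_plt ?posrE// /rho; lra.
pose S := [set m | exists2 l, 0 < l & density_ge L l m].
(* The supremum of all lower densities lies between the lower and the upper density at every
   scale. *)
pose mu := sup S.
have mu_le l M : density_le L l M -> mu <= M.
  move=> hM; apply: ge_sup.
    by exists 0, 1 => // a b _; rewrite mul0r; apply: ler0n.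
  by move=> m [l' l'0 hm]; apply: density_ge_le hm hM.
have [M0 _ hM0] := density_le_exists s0 Ls ltr01.
have mu_ge l m : 0 < l -> density_ge L l m -> m <= mu.
  move=> l'0 hm; apply: ub_le_sup; last by exists l.
  by exists M0 => m' [l' l'0' hm']; apply: density_ge_le hm' hM0.
exists mu, delta; split=> // l1 l10.
have [M1 M10 hM1] := density_le_exists s0 Ls l10.
have c0 : 0 < l0 `^ delta by apply: powR_gt0.
exists (A * (rho^-1 * l0 `^ delta) + (M1 + `|mu|) * l0 `^ delta).
  apply: ltr_wpDl; last by rewrite mulr_gt0// ltr_pwDl.
  by rewrite !mulr_ge0 ?invr_ge0 ?(ltW rho0) ?(ltW c0).
move=> a b l l1l w; have l'0 : 0 < l by apply: lt_le_trans l1l.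
have v0 : 0 < box_vol a b by exact: box_vol_gt0 w.
have ld0 : 0 < l `^ delta by apply: powR_gt0.
have [l0l|ll0] := leP l0 l.
- have K2 : 2 <= K by lra.
  have [k /andP[kl lk]] := expr_bracket K2 l00 l0l.
  have K0 : 0 < K by lra.
  have [m [M [hm hM Mm]]] := gap k.
  have wk := wideW kl w.
  have [h1 h2] := (hm _ _ wk, hM _ _ wk).
  have m1 := mu_ge _ _ (mulr_gt0 (exprn_gt0 k K0) l00) hm.
  have m2 := mu_le _ _ hM.
  apply: (@le_trans _ _ ((M - m) * box_vol a b)).
    have h3 : m * box_vol a b <= mu * box_vol a b by rewrite ler_pM2r.
    have h4 : mu * box_vol a b <= M * box_vol a b by rewrite ler_pM2r.
    by rewrite ler_norml; apply/andP; split; lra.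
  rewrite ler_pM2r//; apply: le_trans Mm _; rewrite -/rho ler_pdivlMr//.
  rewrite ler_wpDr ?mulr_ge0 ?addr_ge0 ?(ltW c0) ?(ltW M10)//.
  rewrite -mulrA ler_wpM2l//.
  apply: (@le_trans _ _ (rho ^+ k * (K ^+ k.+1 * l0) `^ delta)).
    rewrite ler_pM2l ?exprn_gt0// ge0_ler_powR ?nnegrE ?(ltW d0) ?(ltW l'0)//.
      by rewrite mulr_ge0 ?exprn_ge0 ?(ltW K0) ?(ltW l00).
    exact: ltW.
  rewrite powRM ?exprn_ge0 ?(ltW K0) ?(ltW l00)// -powR_mulrn ?(ltW K0)//.
  rewrite -powRrM mulrC (mulrC _ delta) powRrM Kd powR_mulrn ?invr_ge0
    ?(ltW rho0)//.
  rewrite exprS -!mulrA exprVn.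
  have rk : rho ^+ k != 0 by rewrite gt_eqF ?exprn_gt0.
  have r1 : rho != 0 by rewrite gt_eqF.
  by rewrite le_eqVlt; apply/orP; left; apply/eqP; field; rewrite rk r1.
- have N1 := hM1 _ _ (wideW l1l w).
  have N0 : 0 <= hpoints L a b by exact: ler0n.
  apply: (@le_trans _ _ ((M1 + `|mu|) * box_vol a b)).
    apply: le_trans (ler_normB _ _) _.
    by rewrite normrM (gtr0_norm v0) (ger0_norm N0) mulrDl lerD2r.
  rewrite ler_pM2r// ler_pdivlMr// ler_wpDl ?mulr_ge0 ?invr_ge0 ?(ltW rho0)
    ?(ltW c0)//.
  rewrite ler_pM2l ?ltr_pwDl// ge0_ler_powR ?nnegrE ?(ltW d0) ?(ltW l'0)//.
    exact: ltW.
  exact: ltW.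
Qed.

(** * Passage to closed boxes and the asymptotic density *)

Lemma closed_box_discrepancy (R : realType) (d : nat) (L : set 'rV[R]_d.+1)
    (s l mu beta : R) (a b : 'rV[R]_d.+1) :
  0 < s -> uniformly_separated L s -> 0 < l -> wide l a b ->
  (forall b' : 'rV[R]_d.+1, wide l a b' ->
     `|hpoints L a b' - mu * box_vol a b'| <= beta * box_vol a b') ->
  `|npoints (L `&` box a b) - mu * box_vol a b| <= beta * box_vol a b.
Proof.
move=> s0 Ls l0 w hb.
pose up h : 'rV[R]_d.+1 := \row_i (b 0 i + h).
have fin a' b' : finite_set (L `&` hbox a' b') by exact: finite_hbox Ls.
have sub_up h : 0 < h -> L `&` box a b `<=` L `&` hbox a (up h).
  by move=> h0 x [Lx abx]; split=> // i; have := abx i; rewrite mxE; lra.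
have finb : finite_set (L `&` box a b).
  exact: sub_finite_set (sub_up 1 ltr01) (fin _ _).
set N := npoints _; set V := box_vol a b.
have V0 : 0 < V by exact: box_vol_gt0 w.
have NV : hpoints L a b <= N.
  apply: (npoints_le (f := id)) => // x [Lx abx]; split=> // i.
  by have /andP[-> /ltW] := abx i.
have := hb _ w; rewrite -/V ler_norml => /andP[lo hi].
(* No sign is assumed for [beta]; nonnegativity follows because this quantity bounds a number of
   points. *)
have mub : 0 <= (mu + beta) * V.
  have : 0 <= hpoints L a b by exact: ler0n.
  by lra.
suff : N <= (mu + beta) * V by rewrite ler_norml; lra.
pose Z := (mu + beta) * V * 2 ^+ d.+1.
have Z0 : 0 <= Z by rewrite mulr_ge0// exprn_ge0.
(* The closed box lies in a half-open one with sides longer by [t * l], whose relative volume growth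
   is at most [2 ^+ d.+1 * t]. The choice of [t] makes the resulting error [Z * t] at most [e], and
   the cap 1 allows [box_vol_enlarge]. *)
apply/ler_addgt0Pr => e e0; pose t := Num.min 1 (e / (Z + 1)).
have t0 : 0 < t by rewrite lt_min ltr01 divr_gt0//; lra.
have t1 : t <= 1 by rewrite ge_min lexx.
have Zt : Z * t <= e.
  apply: (@le_trans _ _ ((Z + 1) * t)); first by lra.
  by rewrite mulrC -ler_pdivlMr ?ge_min ?lexx ?orbT//; lra.
have tl0 : 0 < t * l by rewrite mulr_gt0.
have wup : wide l a (up (t * l)).
  by move=> i; rewrite mxE; have := w i; lra.
apply: (@le_trans _ _ (hpoints L a (up (t * l)))).
  by apply: (npoints_le (f := id)) => //; apply: sub_up.
have side i : up (t * l) 0 i - a 0 i = b 0 i - a 0 i + t * l.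
  by rewrite mxE; lra.
have tl : 0 <= t * l <= l by rewrite (ltW tl0)/= ler_piMl// ltW.
have := box_vol_enlarge l0 tl w side.
rewrite mulfK ?gt_eqF// -/V => vle.
have := hb _ wup; rewrite ler_norml => /andP[_ hi'].
apply: (@le_trans _ _ ((mu + beta) * ((1 + 2 ^+ d.+1 * t) * V))); last first.
  by move: Zt; rewrite /Z; lra.
apply: (@le_trans _ _ ((mu + beta) * box_vol a (up (t * l)))); first by lra.
by rewrite ler_wpM2l//; move: mub; rewrite pmulr_lge0.
Qed.

Theorem theorem1p2 (R : realType) (d : nat) (L : set 'rV[R]_d.+1) (eps : R)
    (hL : delone L) (eps_gt0 : 0 < eps) (eps_lt : eps < packing_constant L / 2)
    (hrep : eps_linearly_repetitive L eps) :
  exists mu delta : R,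
    [/\ asymptotic_density L mu,
        0 < delta,
        delta < 1 / 2 &
        forall l0 : R, 0 < l0 ->
          exists2 alpha : R, 0 < alpha &
            forall a b : 'rV[R]_d.+1,
              (forall i, a 0 i < b 0 i) -> l0 <= box_width a b ->
              `|npoints (L `&` box a b) - mu * box_vol a b|
                <= alpha * (box_vol a b / box_width a b `^ delta)].
Proof.
have s0 : 0 < packing_constant L by lra.
have Ls := @separated_packing _ _ L.
have [mu [delta [d0 d12 disc]]] := hbox_discrepancy hL eps_gt0 eps_lt hrep.
have box_disc l0 : 0 < l0 -> exists2 alpha, 0 < alpha &
    forall a b l, l0 <= l -> wide l a b ->
    `|npoints (L `&` box a b) - mu * box_vol a b|
      <= alpha / l `^ delta * box_vol a b.
  move=> l00; have [alpha alpha0 h] := disc _ l00; exists alpha => //.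
  move=> a b l l0l w.
  apply: (closed_box_discrepancy s0 Ls (lt_le_trans l00 l0l) w) => b' w'.
  exact: h.
exists mu, delta; split=> // [|l0 l00]; last first.
  have [alpha alpha0 h] := box_disc _ l00; exists alpha => // a b _ l0w.
  rewrite [leRHS]mulrA [leRHS]mulrAC; apply: h => // i.
  exact: bigmin_le.
have [alpha alpha0 h] := box_disc 1 ltr01.
apply/cvgrPdist_lt => e e0; near=> t.
have t1 : 1 <= 2 * t.
  suff : 1 <= t by lra.
  by near: t; apply: nbhs_pinfty_ge; rewrite num_real.
have cube : cball 0 t = box (const_mx (- t)) (const_mx t : 'rV[R]_d.+1).
  apply/seteqP; split=> [x /row_norm_leP xt i|x xt].
    by have := xt i; rewrite !mxE sub0r normrN ler_norml.
  by apply/row_norm_leP => i; have := xt i; rewrite !mxE sub0r normrN ler_norml.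
have V : box_vol (const_mx (- t)) (const_mx t : 'rV[R]_d.+1) = (2 * t) ^+ d.+1.
  rewrite /box_vol (eq_bigr (fun=> 2 * t)) ?prodr_const ?card_ord// => i _.
  by rewrite !mxE; lra.
have w : wide (2 * t) (const_mx (- t)) (const_mx t : 'rV[R]_d.+1).
  by move=> i; rewrite !mxE; lra.
have := h _ _ _ t1 w; rewrite -cube V.
have v0 : 0 < (2 * t) ^+ d.+1 by rewrite exprn_gt0//; lra.
rewrite -ler_pdivrMr// -[X in _ / X]gtr0_norm// -normf_div mulrBl mulfK
  ?gt_eqF//.
rewrite distrC => /le_lt_trans; apply.
rewrite ltr_pdivrMr ?powR_gt0//; last by lra.
rewrite mulrC -ltr_pdivrMr//.
have -> : alpha / e = ((alpha / e) `^ delta^-1) `^ delta.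
  by rewrite -powRrM mulVf ?gt_eqF// powRr1// divr_ge0 ?ltW.
rewrite gt0_ltr_powR ?nnegrE ?powR_ge0//; first by lra.
set T := _ `^ _; suff : T < t by lra.
by near: t; apply: nbhs_pinfty_gt; rewrite num_real.
Unshelve. all: by end_near.
Qed.
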